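(* Let $\Gamma$ be a finite connected tetravalent graph. Then there exists $G\le\mathrm{Aut}(\Gamma)$ such that $\Gamma$ is $G$-half-arc-transitive with $\mathrm{rad}_G(\Gamma)=3$ and $\mathrm{att}_G(\Gamma)=2$ if and only if $\Gamma$ is isomorphic to the dart graph $\mathrm{Dart}(\Lambda)$ of some finite $2$-arc-transitive cubic graph $\Lambda$.
   Context: All graphs are finite and simple. For a tetravalent graph $\Gamma$ and $G\le \mathrm{Aut}(\Gamma)$, $\Gamma$ is $G$-half-arc-transitive if $G$ acts transitively on vertices and edges but not on arcs. Then the $G$-orbits on arcs give two paired orientations of the edges, and for each, every vertex is the tail of two and the head of two incident edges. A $G$-alternating cycle is a cycle in which every two consecutive edges have a common head or a common tail. All $G$-alternating cycles have the same length $2\,\mathrm{rad}_G(\Gamma)$, and any two $G$-alternating cycles sharing a vertex meet in the same number $\mathrm{att}_G(\Gamma)$ of vertices. For a cubic graph $\Lambda$, the dart graph $\mathrm{Dart}(\Lambda)$ has as vertices the arcs (ordered pairs of adjacent vertices) of $\Lambda$, with $(u,v)$ adjacent to $(u',v')$ iff either $u'=v$ and $u\neq v'$, or $u=v'$ and $u'\neq v$. A graph is $2$-arc-transitive if its automorphism group acts transitively on its $2$-arcs (walks $(x,y,z)$ with $x\ne z$). *)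

(* Defs.v *)
From mathcomp Require Import all_boot all_fingroup.
Set Implicit Arguments. Unset Strict Implicit. Unset Printing Implicit Defensive.



Section Graphs.
Variable T : finType.
Variable e : rel T.

Definition simple_graph : Prop := symmetric e /\ irreflexive e.

Definition regular_of_degree (k : nat) : Prop :=
  forall v : T, #|[set w | e v w]| = k.

Definition connected_graph : Prop := forall x y : T, connect e x y.

Definition graph_aut : {set {perm T}} :=
  [set g : {perm T} | [forall x, forall y, e (g x) (g y) == e x y]].

Definition vertex_transitive (G : {set {perm T}}) : Prop :=
  forall x y : T, exists2 g : {perm T}, g \in G & g x = y.

Definition edge_transitive (G : {set {perm T}}) : Prop :=
  forall x y x' y' : T, e x y -> e x' y' ->
    exists2 g : {perm T}, g \in G &
      ((g x = x' /\ g y = y') \/ (g x = y' /\ g y = x')).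

Definition arc_transitive (G : {set {perm T}}) : Prop :=
  forall x y x' y' : T, e x y -> e x' y' ->
    exists2 g : {perm T}, g \in G & (g x = x' /\ g y = y').

Definition half_arc_transitive (G : {set {perm T}}) : Prop :=
  [/\ G \subset graph_aut, vertex_transitive G, edge_transitive G
    & ~ arc_transitive G].

(* the G-orbit of the arc (u, v): one of the two paired orientations *)
Definition arc_orbit (G : {set {perm T}}) (u v : T) : {set T * T} :=
  [set (g u, g v) | g : {perm T} in G].

Definition graph_cycle (s : seq T) : Prop :=
  [/\ uniq s, 3 <= size s & path.cycle e s].

(* s is a cycle in which consecutive edges have a common head or a
   common tail w.r.t. the orientation D *)
Definition alternating_wrt (D : {set T * T}) (s : seq T) : Prop :=
  forall x, x \in s -> ((prev s x, x) \in D) = ((next s x, x) \in D).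

Definition G_alternating_cycle (G : {set {perm T}}) (s : seq T) : Prop :=
  graph_cycle s /\
  exists u v, e u v /\ alternating_wrt (arc_orbit G u v) s.

(* arcs (in both directions) of the cycle s: determines the cycle as a
   subgraph *)
Definition cycle_arcs (s : seq T) : {set T * T} :=
  [set p : T * T | (p.1 \in s) && ((p.2 == next s p.1) || (p.1 == next s p.2))].

Definition rad_eq (G : {set {perm T}}) (n : nat) : Prop :=
  (exists s, G_alternating_cycle G s) /\
  forall s, G_alternating_cycle G s -> size s = (2 * n)%N.

Definition att_eq (G : {set {perm T}}) (n : nat) : Prop :=
  forall s1 s2, G_alternating_cycle G s1 -> G_alternating_cycle G s2 ->
    cycle_arcs s1 != cycle_arcs s2 ->
    (exists x, (x \in s1) && (x \in s2)) ->
    #|[set x | (x \in s1) && (x \in s2)]| = n.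

Definition two_arc (x y z : T) : bool := [&& e x y, e y z & x != z].

Definition two_arc_transitive : Prop :=
  forall x y z x' y' z', two_arc x y z -> two_arc x' y' z' ->
    exists2 g : {perm T}, g \in graph_aut & [/\ g x = x', g y = y' & g z = z'].

End Graphs.

Definition dart (U : finType) (f : rel U) : finType :=
  {p : U * U | f p.1 p.2}.

Definition dart_rel (U : finType) (f : rel U) : rel (dart f) :=
  fun a b =>
    let: (u, v) := val a in let: (u', v') := val b in
    ((u' == v) && (u != v')) || ((u == v') && (u' != v)).

Definition graph_iso (T U : finType) (e : rel T) (f : rel U) : Prop :=
  exists2 phi : T -> U, bijective phi & forall x y, f (phi x) (phi y) = e x y.
Arguments dart_rel {U} f.

(* Main.v *)
Require Import Defs.
From mathcomp Require Import all_boot all_fingroup.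
Set Implicit Arguments.
Unset Strict Implicit.
Unset Printing Implicit Defensive.

(** Each vertex of [T] is a tail on one alternating hexagon and a head on
    another. An element of [G] fixing a vertex [x] and swapping its two
    out-neighbours reflects the first hexagon, so if the two hexagons share
    exactly two vertices the second one is antipodal to [x]. Hence the hexagons,
    adjacent when they meet, form a cubic graph whose darts are the vertices of
    [T]; its 2-arcs are the arcs of the orientation, on which [G] is transitive.
    Conversely, in a dart graph the six darts at a vertex of the cubic graph
    form an alternating cycle for the orientation (u,v) -> (v,w), every
    alternating cycle is of this kind, and 2-arc-transitivity is transitivity on
    this orientation. *)

Ltac not_uniq U := by move: U; rewrite /= ?inE ?eqxx ?orbT ?andbF.

(** * Orientations and their alternating cycles *)

Section AlternatingCycles.
Variables (T : finType) (d : rel T).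

(** Even-indexed vertices are tails and odd-indexed ones heads, so the symmetries of this form are
    the rotations by two and the reflections in a vertex. *)
Definition hexagon (x0 x1 x2 x3 x4 x5 : T) : bool :=
  uniq [:: x0; x1; x2; x3; x4; x5] &&
  [&& d x0 x1, d x2 x1, d x2 x3, d x4 x3, d x4 x5 & d x0 x5].

Lemma hexagon_rot2 x0 x1 x2 x3 x4 x5 :
  hexagon x0 x1 x2 x3 x4 x5 -> hexagon x2 x3 x4 x5 x0 x1.
Proof.
case/andP=> U /and5P[d01 d21 d23 d43 /andP[d45 d05]].
by rewrite /hexagon -(rot_uniq 4) U d01 d21 d23 d43 d45 d05.
Qed.

Lemma hexagon_rev x0 x1 x2 x3 x4 x5 :
  hexagon x0 x1 x2 x3 x4 x5 -> hexagon x0 x5 x4 x3 x2 x1.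
Proof.
case/andP=> U /and5P[d01 d21 d23 d43 /andP[d45 d05]].
by rewrite /hexagon -(rot_uniq 1) -rev_uniq U d01 d21 d23 d43 d45 d05.
Qed.

(** Lets [next] on an explicit list be computed by position, without comparing entries. *)
Lemma next_nth_uniq (s : seq T) y0 i : uniq s -> i < size s ->
  next s (nth y0 s i) = nth y0 (rot 1 s) i.
Proof.
case: s => [|y s] // U lis; rewrite (set_nth_default y) //.
rewrite [RHS](set_nth_default y) ?size_rot // next_nth mem_nth // index_uniq //.
by rewrite rot1_cons nth_rcons_default.
Qed.

(** Shifting the condition by one vertex removes [prev], so that only [next] has to be evaluated on
    explicit cycles. *)
Lemma alternating_next (s : seq T) : uniq s ->
  alternating_wrt [set p | d p.1 p.2] s <->
  {in s, forall x, d x (next s x) = d (next s (next s x)) (next s x)}.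
Proof.
move=> Us; split=> A x xs.
  by have := A (next s x); rewrite mem_next !inE /= prev_next //; apply.
rewrite !inE /=; have := A (prev s x); rewrite mem_prev next_prev //; exact.
Qed.

(** The common interface of both directions: [d] is an arc orbit of the given group in one, and the
    rule (u,v) -> (v,w) on darts in the other. *)
Definition orientation_of (e : rel T) (G : {set {perm T}}) : Prop :=
  [/\ forall x y, e x y = d x y || d y x,
      forall x y, d x y -> ~~ d y x,
      {in G, forall (g : {perm T}) x y, d (g x) (g y) = d x y}
    & forall x y x' y', d x y -> d x' y' ->
        exists2 g : {perm T}, g \in G & g x = x' /\ g y = y'].

Variables (e : rel T) (G : {set {perm T}}).
Hypothesis orG : orientation_of e G.

Lemma arc_orbit_orientation u v : d u v ->
  arc_orbit G u v = [set p | d p.1 p.2].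
Proof.
case: orG => _ _ dG trG duv; apply/setP=> -[x y]; rewrite inE /=.
apply/imsetP/idP => [[g gG [-> ->]]|dxy]; first by rewrite dG.
by have [g gG [<- <-]] := trG _ _ _ _ duv dxy; exists g.
Qed.

Lemma arc_orbit_orientation_rev u v : d v u ->
  arc_orbit G u v = [set p | d p.2 p.1].
Proof.
case: orG => _ _ dG trG duv; apply/setP=> -[x y]; rewrite inE /=.
apply/imsetP/idP => [[g gG [-> ->]]|dxy]; first by rewrite dG.
by have [g gG [<- <-]] := trG _ _ _ _ duv dxy; exists g.
Qed.

(** A [G]-alternating cycle may refer to either of the two paired orientations. Reversing all arcs
    exchanges common heads with common tails, so both give the same condition and [d] can be fixed
    once and for all. *)
Lemma G_alternating_orientation s : (exists u v, e u v) ->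
  G_alternating_cycle e G s <->
  graph_cycle e s /\ alternating_wrt [set p | d p.1 p.2] s.
Proof.
case: (orG) => eE asym _ _ [u [v euv]]; split; last first.
  move=> [cs A]; split=> //.
  move: (euv); rewrite eE => /orP[duv|dvu].
    by exists u, v; split; rewrite ?arc_orbit_orientation.
  by exists v, u; rewrite eE dvu arc_orbit_orientation.
move=> [cs [x [y [exy A]]]]; split=> //; move: A exy.
rewrite eE => + /orP[dxy|dyx]; first by rewrite arc_orbit_orientation.
rewrite arc_orbit_orientation_rev // => A z zs.
have [_ _ cyc] := cs.
have ezn : e z (next s z) by apply: next_cycle.
have epz : e (prev s z) z by apply: prev_cycle.
have := A z zs; rewrite !inE /=.
move: ezn epz; rewrite !eE.
have := @asym z (next s z); have := @asym (prev s z) z.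
(* Each cycle edge has exactly one direction, so the condition for the reversed orientation is the
   one for [d] with both sides negated. *)
by do 4!case: (d _ _) => //=; move=> // H1 H2; have := H1 isT; have := H2 isT.
Qed.

Lemma hexagon_G_alternating x0 x1 x2 x3 x4 x5 :
  hexagon x0 x1 x2 x3 x4 x5 ->
  G_alternating_cycle e G [:: x0; x1; x2; x3; x4; x5].
Proof.
case: (orG) => eE asym _ _.
case/andP=> U /and5P[d01 d21 d23 d43 /andP[d45 d05]].
apply/G_alternating_orientation; first by exists x0, x1; rewrite eE d01.
split; first by split=> //=; rewrite !eE d01 d21 d23 d43 d45 d05 ?orbT.
apply/alternating_next => // x; have n := next_nth_uniq x0 U.
rewrite !inE => xs; pose s := [:: x0; x1; x2; x3; x4; x5].
have n0 : next s x0 = x1 := n 0 isT. have n1 : next s x1 = x2 := n 1 isT.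
have n2 : next s x2 = x3 := n 2 isT. have n3 : next s x3 = x4 := n 3 isT.
have n4 : next s x4 = x5 := n 4 isT. have n5 : next s x5 = x0 := n 5 isT.
have := (asym _ _ d01, asym _ _ d21, asym _ _ d23, asym _ _ d43,
  asym _ _ d45, asym _ _ d05).
move=> [[[[[/negPf a1 /negPf a2] /negPf a3] /negPf a4] /negPf a5] /negPf a6].
by case/or4P: xs => [/eqP->|/eqP->|/eqP->|/or3P[]/eqP->];
  rewrite ?(n0, n1, n2, n3, n4, n5) ?d01 ?d21 ?d23 ?d43 ?d45 ?d05
   ?a1 ?a2 ?a3 ?a4 ?a5 ?a6.
Qed.

End AlternatingCycles.

(** The point is asymmetry: if the orbit contained an arc and its reverse, edge transitivity would
    put all arcs into it, and [G] would be arc-transitive. *)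
Lemma half_arc_transitive_orientation (T : finType) (e : rel T)
    (G : {group {perm T}}) u v : symmetric e ->
  half_arc_transitive e G -> e u v ->
  orientation_of (fun x y => (x, y) \in arc_orbit G u v) e G.
Proof.
move=> sym [/subsetP GA _ etr natr] euv.
have eG (g : {perm T}) x y : g \in G -> e (g x) (g y) = e x y.
  by move/GA; rewrite inE => /forallP/(_ x)/forallP/(_ y)/eqP.
have DG (g : {perm T}) : g \in G -> (g u, g v) \in arc_orbit G u v.
  by move=> gG; apply: imset_f.
have eD x y : e x y -> (x, y) \in arc_orbit G u v \/ (y, x) \in arc_orbit G u v.
  move=> exy; have [g gG] := etr _ _ _ _ euv exy.
  by case=> -[<- <-]; [left | right]; apply: DG.
have De x y : (x, y) \in arc_orbit G u v -> e x y.
  by case/imsetP=> g gG [-> ->]; rewrite eG.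
have tr x y x' y' : (x, y) \in arc_orbit G u v ->
    (x', y') \in arc_orbit G u v ->
    exists2 g : {perm T}, g \in G & g x = x' /\ g y = y'.
  case/imsetP=> g gG [-> ->] /imsetP[h hG [-> ->]].
  by exists (g^-1 * h)%g; rewrite ?groupM ?groupV // !permM !permK.
split=> // [x y|x y Dxy|g gG x y].
- apply/idP/orP => [/eD//|[/De//|/De]].
  by rewrite sym.
- apply/negP=> Dyx; apply: natr.
  have allD a b : e a b -> (a, b) \in arc_orbit G u v.
    case/eD => // /(tr _ _ _ _ Dxy)[g gG [<- <-]].
    case/imsetP: Dyx => h hG [-> ->].
    by rewrite -!permM; apply: DG; rewrite groupM.
  by move=> a b a' b' /allD Dab /allD; apply: tr.
- apply/idP/idP => /imsetP[h hG [eqx eqy]].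
    rewrite -(permK g x) -(permK g y) eqx eqy -!permM.
    by apply: DG; rewrite groupM ?groupV.
  by rewrite eqx eqy -!permM; apply: DG; rewrite groupM.
Qed.

(** * The cubic graph whose vertices are the alternating hexagons *)

Section HexagonStructure.
Variables (T : finType) (e d : rel T) (G : {set {perm T}}).
Hypothesis orG : orientation_of d e G.
Hypothesis out2 : forall x y y' z,
  d x y -> d x y' -> y != y' -> d x z -> z = y \/ z = y'.
Hypothesis in2 : forall x y y' z,
  d y x -> d y' x -> y != y' -> d z x -> z = y \/ z = y'.
Hypothesis hexE : forall x y, d x y ->
  exists x2 x3 x4 x5, hexagon d x y x2 x3 x4 x5.
Hypothesis out_ex : forall x, exists y, d x y.
Hypothesis in_ex : forall x, exists y, d y x.
Hypothesis attG : att_eq e G 2.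

(* The tails of the alternating cycle on which [x] is a tail; this set stands
   for that cycle, i.e. for the vertex of the cubic graph where the dart [x]
   ends. [cotails_in x] likewise stands for the one where it starts. *)
Definition cotails (x : T) : {set T} := [set z | [exists y, d x y && d z y]].
Definition cotails_in (y : T) : {set T} := \bigcup_(x | d x y) cotails x.

(** The hexagon already uses both out-neighbours of a tail. With [hexagon_in], the dual for heads,
    and the symmetries, a hexagon is closed under arcs leaving its tails or entering its heads. *)
Lemma hexagon_out x0 x1 x2 x3 x4 x5 z : hexagon d x0 x1 x2 x3 x4 x5 ->
  d x0 z -> z \in [:: x1; x5].
Proof.
case/andP=> U /and5P[d01 d21 d23 d43 /andP[d45 d05]] d0z.
have n15 : x1 != x5 by apply/eqP=> E; subst; not_uniq U.
by rewrite !inE; case: (out2 d01 d05 n15 d0z) => ->; rewrite eqxx ?orbT.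
Qed.

Lemma hexagon_in x0 x1 x2 x3 x4 x5 z : hexagon d x0 x1 x2 x3 x4 x5 ->
  d z x1 -> z \in [:: x0; x2].
Proof.
case/andP=> U /and5P[d01 d21 d23 d43 /andP[d45 d05]] d1z.
have n02 : x0 != x2 by apply/eqP=> E; subst; not_uniq U.
by rewrite !inE; case: (in2 d01 d21 n02 d1z) => ->; rewrite eqxx ?orbT.
Qed.

Lemma cotails_hexagon x0 x1 x2 x3 x4 x5 : hexagon d x0 x1 x2 x3 x4 x5 ->
  cotails x0 =i [:: x0; x2; x4].
Proof.
move=> H z; have Hr := hexagon_rev H; rewrite !inE.
have /andP[U /and5P[d01 d21 d23 d43 /andP[d45 d05]]] := H.
apply/existsP/or3P => [[y /andP[d0y dzy]]|].
  move: (hexagon_out H d0y); rewrite !inE => /orP[]/eqP Ey; subst y.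
    by move: (hexagon_in H dzy); rewrite !inE =>/orP[]->; constructor.
  by move: (hexagon_in Hr dzy); rewrite !inE =>/orP[]->; constructor.
by case=> /eqP->; [exists x1 | exists x1 | exists x5]; apply/andP.
Qed.

Lemma cotails_hexagon_eq x0 x1 x2 x3 x4 x5 z : hexagon d x0 x1 x2 x3 x4 x5 ->
  z \in [:: x0; x2; x4] -> cotails z = cotails x0.
Proof.
move=> H; have H2 := hexagon_rot2 H; have H4 := hexagon_rot2 H2.
rewrite !inE => /or3P[]/eqP->; apply/setP=> y;
  rewrite ?(cotails_hexagon H) ?(cotails_hexagon H2) ?(cotails_hexagon H4) //;
  by rewrite !inE; do 3!case: eqP.
Qed.

(** All in-neighbours of [y] are tails on one hexagon, so the terms of the union coincide. *)
Lemma cotails_inE x y : d x y -> cotails_in y = cotails x.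
Proof.
move=> dxy; have [x2 [x3 [x4 [x5 H]]]] := hexE dxy.
apply/setP=> z; apply/bigcupP/idP => [[x' dx'y]|zx]; last by exists x.
rewrite (cotails_hexagon_eq H) //.
by move: (hexagon_in H dx'y); rewrite !inE => /orP[]->; rewrite ?orbT.
Qed.

Lemma cotails_refl x : x \in cotails x.
Proof. by have [y dxy] := out_ex x; rewrite inE; apply/existsP; exists y; rewrite dxy. Qed.

Lemma cotails_eq x y : (y \in cotails x) = (cotails y == cotails x).
Proof.
have [a dxa] := out_ex x; have [x2 [x3 [x4 [x5 H]]]] := hexE dxa.
apply/idP/eqP => [|<-]; last exact: cotails_refl.
by rewrite (cotails_hexagon H); apply: cotails_hexagon_eq H.
Qed.

Lemma hexagon_perm g x0 x1 x2 x3 x4 x5 : g \in G ->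
  hexagon d (g x0) (g x1) (g x2) (g x3) (g x4) (g x5) =
  hexagon d x0 x1 x2 x3 x4 x5.
Proof.
case: orG => _ _ dG _ gG; rewrite /hexagon !dG //.
by rewrite -[in RHS](map_inj_uniq (@perm_inj _ g)).
Qed.

(** Starting from one arc, every further vertex is forced, being the in- or out-neighbour that has
    not just been used. This determines how an element of [G] acts on a hexagon from its action on
    one arc. *)
Lemma hexagon_unique x0 x1 x2 x3 x4 x5 y2 y3 y4 y5 :
  hexagon d x0 x1 x2 x3 x4 x5 -> hexagon d x0 x1 y2 y3 y4 y5 ->
  [/\ y2 = x2, y3 = x3, y4 = x4 & y5 = x5].
Proof.
move=> H K.
have /andP[V /and5P[k01 k21 k23 k43 /andP[k45 k05]]] := K.
have /andP[U _] := H.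
have E2 : y2 = x2.
  move: (hexagon_in H k21); rewrite !inE => /orP[]/eqP // E.
  by subst; not_uniq V.
have E5 : y5 = x5.
  move: (hexagon_out H k05); rewrite !inE => /orP[]/eqP // E.
  by subst; not_uniq V.
subst y2 y5.
have E3 : y3 = x3.
  move: (hexagon_out (hexagon_rot2 H) k23); rewrite !inE => /orP[]/eqP // E.
  by subst; not_uniq V.
have E4 : y4 = x4.
  move: (hexagon_in (hexagon_rev H) k45); rewrite !inE => /orP[]/eqP // E.
  by subst; not_uniq V.
by [].
Qed.

(** Here [t] is antipodal to [x] on the first hexagon and a head there. On the second it must be a
    tail: were it a head on both, its in-neighbour [z] would be a third common vertex. *)
Lemma hexagons_common x a z t w b p0 p2 p3 p4 p5 :
  hexagon d x a z t w b -> hexagon d p0 x p2 p3 p4 p5 ->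
  t \in [:: p0; p2; p4] /\
  forall y, y \in [:: x; a; z; t; w; b] -> y \in [:: p0; x; p2; p3; p4; p5] ->
    y \in [:: x; t].
Proof.
move=> H K; case: (orG) => eE asym dG trG.
have /andP[U /and5P[xa za zt wt /andP[wb xb]]] := H.
have /andP[V /and5P[k01 k21 k23 k43 /andP[k45 k05]]] := K.
pose s1 := [:: x; a; z; t; w; b]; pose s2 := [:: p0; x; p2; p3; p4; p5].
(* The arc from [x] to [a] separates the cycles: on the second one both neighbours of [x] are
   in-neighbours. *)
have ne : cycle_arcs s1 != cycle_arcs s2.
  have xa1 : (x, a) \in cycle_arcs s1 by rewrite !inE /= !eqxx.
  have Un : uniq s2 by [].
  have n0 : next s2 p0 = x := next_nth_uniq p0 Un (isT : 0 < 6).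
  have nx : next s2 x = p2 := next_nth_uniq p0 Un (isT : 1 < 6).
  apply/eqP=> E12; move: xa1; rewrite E12 in_set => /andP[_ /orP[]] /eqP E.
    by move: (asym _ _ xa); rewrite (etrans E nx : a = p2) k21.
  have E' : a = p0.
    by rewrite -(prev_next Un a) -(E : x = next s2 a) -[x]n0 prev_next.
  by move: (asym _ _ xa); rewrite E' k01.
have xx : exists y, (y \in s1) && (y \in s2).
  by exists x; rewrite !inE !eqxx ?orbT.
have := attG (hexagon_G_alternating orG H) (hexagon_G_alternating orG K) ne xx.
set I := [set y | _] => cI.
have xI : x \in I by rewrite !inE !eqxx ?orbT.
have [q [qI qx Iq]] : exists q, [/\ q \in I, q != x & forall y, y \in I -> y = x \/ y = q].
  move: cI; rewrite (cardsD1 x) xI => -[] /eqP/cards1P[q Eq]; exists q.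
  have : q \in I :\ x by rewrite Eq inE.
  rewrite in_setD1 => /andP[qx qI]; split=> // y yI.
  case: (eqVneq y x) => [|yx]; first by left.
  by right; apply/set1P; rewrite -Eq in_setD1 yx.
(* [g] reflects the first hexagon in [x] and preserves both cycles, hence
   their second common vertex, which must be antipodal to [x]. *)
have [g gG [gx ga]] := trG _ _ _ _ xa xb.
have := H; rewrite -(hexagon_perm _ _ _ _ _ _ gG) gx ga => gH.
have [gz gt gw gb] := hexagon_unique (hexagon_rev H) gH.
(* Since [g] fixes [x], it keeps or swaps the in-neighbours [p0] and [p2]; by uniqueness the image
   of the second hexagon is that hexagon or its reflection in [x]. *)
have gK : {in s2, forall y, g y \in s2}.
  have := K; rewrite -(hexagon_perm _ _ _ _ _ _ gG) gx => gK.
  have /andP[_ /and5P[g01 _ _ _ _]] := gK.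
  have : g p0 \in [:: p0; p2] by apply: hexagon_in K g01.
  rewrite !inE => /orP[]/eqP g0.
    rewrite g0 in gK; have [E2 E3 E4 E5] := hexagon_unique K gK.
    by move=> y yK; move: (yK); rewrite !inE => /or4P[/eqP->|/eqP->|/eqP->|/or3P[]/eqP->];
      rewrite ?g0 ?gx ?E2 ?E3 ?E4 ?E5 eqxx ?orbT.
  rewrite g0 in gK; have K' := hexagon_rev (hexagon_rot2 K).
  have [E2 E3 E4 E5] := hexagon_unique K' gK.
  by move=> y yK; move: (yK); rewrite !inE => /or4P[/eqP->|/eqP->|/eqP->|/or3P[]/eqP->];
    rewrite ?g0 ?gx ?E2 ?E3 ?E4 ?E5 eqxx ?orbT.
have gq : g q = q.
  have : g q \in I.
    move: qI; rewrite [q \in _]inE => /andP[q1 q2]; rewrite inE gK // andbT.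
    by move: q1; rewrite !inE => /or4P[/eqP->|/eqP->|/eqP->|/or3P[]/eqP->];
      rewrite ?gx ?ga ?gz ?gt ?gw ?gb eqxx ?orbT.
  by case/Iq=> // E; move: qx; rewrite -(inj_eq (@perm_inj _ g)) E gx eqxx.
(* The reflection swaps [a] with [b] and [z] with [w], leaving only [x] and [t] fixed. *)
have Eq : q = t.
  move: qI; rewrite [q \in _]inE => /andP[+ _].
  rewrite !inE (negPf qx) /= => /or4P[/eqP E|/eqP E|/eqP//|/orP[]/eqP E];
    move: gq; rewrite E ?ga ?gz ?gw ?gb => E'; exfalso; clear -U E';
    by subst; not_uniq U.
subst q; have zI : z \notin s2.
  apply/negP=> zs; have /Iq : z \in I by rewrite inE zs !inE eqxx ?orbT.
  by case=> E; subst; not_uniq U.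
split; last first.
  move=> y y1 y2; have /Iq : y \in I by rewrite inE y1.
  by case=> ->; rewrite !inE eqxx ?orbT.
move: qI; rewrite inE => /andP[_]; rewrite !inE.
case/or4P=> [->//|/eqP E|->|/or3P[/eqP E|->|/eqP E]]; rewrite ?orbT //; exfalso.
- by rewrite E eqxx in qx.
- subst t; move: (hexagon_in (hexagon_rot2 K) zt) zI; rewrite !inE.
  by case/orP=>/eqP->; rewrite eqxx ?orbT.
- subst t; move: (hexagon_in (hexagon_rev K) zt) zI; rewrite !inE.
  by case/orP=>/eqP->; rewrite eqxx ?orbT.
Qed.

(** Passing to the antipode is the reversal of darts; this will make adjacency of hexagons
    symmetric. *)
Lemma cotails_antipode x a z t w b : hexagon d x a z t w b ->
  cotails t = cotails_in x /\ cotails_in t = cotails x.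
Proof.
move=> H; have [p dpx] := in_ex x; have [p2 [p3 [p4 [p5 K]]]] := hexE dpx.
rewrite (cotails_inE dpx); split.
  have [tK _] := hexagons_common H K.
  exact: (cotails_hexagon_eq K).
have /andP[U /and5P[xa za zt wt /andP[wb xb]]] := H.
by rewrite (cotails_inE zt) (cotails_hexagon_eq H) // !inE eqxx orbT.
Qed.

Lemma hexagon_outs x0 x1 x2 x3 x4 x5 y z : hexagon d x0 x1 x2 x3 x4 x5 ->
  cotails z = cotails x0 -> d z y -> y \in [:: x1; x3; x5].
Proof.
move=> H /eqP; rewrite -cotails_eq (cotails_hexagon H) !inE.
have H2 := hexagon_rot2 H; have H4 := hexagon_rot2 H2.
case/or3P=>/eqP-> => [/(hexagon_out H)|/(hexagon_out H2)|/(hexagon_out H4)];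
  by rewrite !inE => /orP[]->; rewrite ?orbT.
Qed.

(** A dart is determined by its ends: [y] lies on both hexagons through [x], so it is [x] or the
    antipode [t], and [t] is not a tail on the first hexagon. *)
Lemma cotails_pair_inj x y :
  cotails x = cotails y -> cotails_in x = cotails_in y -> x = y.
Proof.
move=> Ex Ei; have [p dpx] := in_ex x; have [p2 [p3 [p4 [p5 K]]]] := hexE dpx.
have [a dxa] := out_ex x; have [z [t [w [b H]]]] := hexE dxa.
have [q dqy] := in_ex y.
move: Ei; rewrite (cotails_inE dpx) (cotails_inE dqy) => Ei.
have yK := hexagon_outs K (esym Ei) dqy.
have : y \in cotails x by rewrite cotails_eq Ex.
rewrite (cotails_hexagon H) => yH.
have [_] := hexagons_common H K; move=> /(_ y).
have -> : y \in [:: x; a; z; t; w; b].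
  by move: yH; rewrite !inE => /or3P[]->; rewrite ?orbT.
have -> : y \in [:: p; x; p2; p3; p4; p5].
  by move: yK; rewrite !inE => /or3P[]->; rewrite ?orbT.
move=> /(_ isT isT); rewrite !inE => /orP[/eqP//|/eqP Et].
have /andP[U _] := H.
by subst y; move: yH; rewrite !inE => /or3P[]/eqP E; subst; not_uniq U.
Qed.

(** This is the arc rule of a dart graph. The hexagon on which [x] is a tail has three heads; the
    inequality discards the antipode of [x], its reverse dart, and leaves the two out-neighbours. *)
Lemma orientation_cotails x y :
  d x y = (cotails_in y == cotails x) && (cotails_in x != cotails y).
Proof.
have [a dxa] := out_ex x; have [z [t [w [b H]]]] := hexE dxa.
have [Et Eit] := cotails_antipode H; have /andP[U _] := H.
apply/idP/andP=> [dxy|[/eqP Ey ny]].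
  rewrite (cotails_inE dxy) eqxx; split=> //; apply/eqP=> E.
  have Eyt : y = t by apply: cotails_pair_inj; rewrite ?Et ?Eit // (cotails_inE dxy).
  subst y; move: (hexagon_out H dxy); rewrite !inE.
  by case/orP=> /eqP E'; subst; not_uniq U.
have [p dpy] := in_ex y; have := hexagon_outs H _ dpy; rewrite -(cotails_inE dpy).
have /andP[_ /and5P[xa za zt wt /andP[wb xb]]] := H.
move=> /(_ Ey); rewrite !inE => /or3P[]/eqP Eyt; subst y => //.
by rewrite Et eqxx in ny.
Qed.

Lemma cotails_in_neq x : cotails_in x != cotails x.
Proof.
have [p dpx] := in_ex x; have [p2 [p3 [p4 [p5 K]]]] := hexE dpx.
rewrite (cotails_inE dpx) eq_sym -cotails_eq (cotails_hexagon K).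
have /andP[V _] := K; apply/negP; rewrite !inE.
by case/or3P=> /eqP E; subst; not_uniq V.
Qed.

Lemma cotails_perm g x : g \in G -> cotails (g x) = g @: cotails x.
Proof.
case: orG => _ _ dG _ gG; apply/setP=> z; rewrite -{1}(permKV g z).
rewrite -[z in RHS](permKV g z) (mem_imset _ _ (@perm_inj _ g)) !inE.
apply/existsP/existsP=> -[y /andP[d1 d2]]; last first.
  by exists (g y); rewrite !dG ?d1.
exists ((g^-1)%g y); move: d1 d2; rewrite -{1 2}[y](permKV g) !(dG g gG).
by move=> -> ->.
Qed.

Lemma cotails_in_perm g x : g \in G -> cotails_in (g x) = g @: cotails_in x.
Proof.
move=> gG; have [p dpx] := in_ex x; rewrite (cotails_inE dpx).
by rewrite -cotails_perm //; apply: cotails_inE; case: orG => _ _ ->.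
Qed.

Lemma card_cotails x : #|cotails x| = 3.
Proof.
have [a dxa] := out_ex x; have [z [t [w [b H]]]] := hexE dxa.
rewrite (eq_card (cotails_hexagon H)); have /andP[U _] := H.
apply: (@card_uniqP _ [:: x; z; w]).
by apply: subseq_uniq U; rewrite /= !eqxx; do !case: eqP.
Qed.

Definition cotail_class : finType := {A : {set T} | A \in [set cotails x | x in T]}.

(** The name refers to [x] as a dart: its head is the hexagon on which the vertex [x] is a tail, and
    conversely for [tail_class]. *)
Definition head_class x : cotail_class := Sub (cotails x) (imset_f _ isT).

Lemma cotails_in_class x : cotails_in x \in [set cotails x | x in T].
Proof. by have [p dpx] := in_ex x; rewrite (cotails_inE dpx) imset_f. Qed.

Definition tail_class x : cotail_class := Sub (cotails_in x) (cotails_in_class x).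

Definition class_rel : rel cotail_class := fun A B =>
  [exists x, (tail_class x == A) && (head_class x == B)].

Lemma class_relP A B :
  reflect (exists x, tail_class x = A /\ head_class x = B) (class_rel A B).
Proof.
by apply: (iffP existsP) => -[x]; [case/andP=> /eqP ? /eqP ?| case=> <- <-];
  exists x; rewrite ?eqxx.
Qed.

Lemma class_pair_inj x y :
  head_class x = head_class y -> tail_class x = tail_class y -> x = y.
Proof.
by move=> /(congr1 val) /= Eh /(congr1 val) /= Et; apply: cotails_pair_inj.
Qed.

Lemma orientation_class x y :
  d x y = (tail_class y == head_class x) && (tail_class x != head_class y).
Proof. by rewrite orientation_cotails -!val_eqE. Qed.

Lemma class_rel_sym : symmetric class_rel.
Proof.
suff imp A B : class_rel A B -> class_rel B A by move=> A B; apply/idP/idP; apply: imp.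
case/class_relP=> x [<- <-]; apply/class_relP.
have [a dxa] := out_ex x; have [z [t [w [b H]]]] := hexE dxa.
by have [Et Eit] := cotails_antipode H; exists t; split; apply: val_inj.
Qed.

Lemma class_rel_irr : irreflexive class_rel.
Proof.
move=> A; apply/class_relP=> -[x [<- /(congr1 val) /= E]].
by have := cotails_in_neq x; rewrite E eqxx.
Qed.

Lemma class_rel_regular : regular_of_degree class_rel 3.
Proof.
move=> A; have /imsetP[x _ Ex] := valP A.
(* By symmetry the neighbours of [A] are the starting points of the darts ending in [A], which are
   the three tails of that hexagon. *)
have -> : [set B | class_rel A B] = tail_class @: cotails x.
  apply/setP=> B; rewrite inE class_rel_sym.
  apply/class_relP/imsetP=> [[y [EB EA]]|[y yx ->]]; exists y => //.
    by rewrite cotails_eq -Ex -EA.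
  by split=> //; apply: val_inj; rewrite Ex; apply/eqP; rewrite -cotails_eq.
rewrite card_in_imset ?card_cotails // => y z yx zx; apply: class_pair_inj.
by apply: val_inj; move: yx zx; rewrite !cotails_eq => /eqP /= -> /eqP ->.
Qed.

Lemma class_rel_two_arc_transitive : two_arc_transitive class_rel.
Proof.
have key A B C : two_arc class_rel A B C -> exists x y,
    [/\ d x y, tail_class x = A, head_class x = B & head_class y = C].
  case/and3P=> /class_relP[x [xA xB]] /class_relP[y [yB yC]] AC.
  by exists x, y; rewrite orientation_class xA xB yB yC eqxx AC.
move=> A B C A' B' C' /key[x [y [dxy <- <- <-]]] /key[x' [y' [dxy' <- <- <-]]].
have [_ _ _ /(_ _ _ _ _ dxy dxy') [g gG [<- <-]]] := orG.
have gU (D : cotail_class) : g @: val D \in [set cotails x | x in T].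
  by have /imsetP[z _ ->] := valP D; rewrite -cotails_perm // imset_f.
(* The permutation of the hexagons induced by [g]. *)
pose h (D : cotail_class) : cotail_class := Sub (g @: val D) (gU D).
have h_inj : injective h.
  by move=> D E /(congr1 val) /= /(imset_inj (@perm_inj _ g)) /val_inj.
have hh z : h (head_class z) = head_class (g z).
  by apply: val_inj; rewrite /= cotails_perm.
have ht z : h (tail_class z) = tail_class (g z).
  by apply: val_inj; rewrite /= cotails_in_perm.
exists (perm h_inj); last by rewrite !permE !hh ht.
rewrite inE; apply/forallP=> D; apply/forallP=> E; rewrite !permE.
apply/eqP; apply/class_relP/class_relP=> -[z [zD zE]]; last first.
  by exists (g z); rewrite -hh -ht zD zE.
exists ((g^-1)%g z); split; apply: h_inj; by rewrite ?hh ?ht permKV.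
Qed.

Lemma dart_class_iso : graph_iso e (dart_rel class_rel).
Proof.
have phiP x : class_rel (tail_class x, head_class x).1 (tail_class x, head_class x).2.
  by apply/class_relP; exists x.
pose phi x : dart class_rel := exist _ (tail_class x, head_class x) (phiP x).
exists phi; last first.
  by have [eE _ _ _] := orG; move=> x y; rewrite eE !orientation_class.
have sur p : exists x, phi x == p.
  case: p => -[A B] /= pP; have /class_relP[x [xA xB]] := pP.
  by exists x; rewrite -val_eqE /= xA xB.
exists (fun p => xchoose (sur p)) => [x|p]; last exact/eqP/(xchooseP (sur p)).
have /eqP E := xchooseP (sur (phi x)).
by apply: class_pair_inj; [move: (congr1 (snd \o val) E)|move: (congr1 (fst \o val) E)].
Qed.

End HexagonStructure.

(** * Local structure obtained from radius 3 and valency 4 *)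

Lemma dart_of_rad3_att2 (T : finType) (e : rel T) (G : {group {perm T}}) :
  simple_graph e -> regular_of_degree e 4 ->
  half_arc_transitive e G -> rad_eq e G 3 -> att_eq e G 2 ->
  exists (U : finType) (f : rel U),
    [/\ simple_graph f, regular_of_degree f 3, two_arc_transitive f
      & graph_iso e (dart_rel f)].
Proof.
move=> [sym irr] deg hat [[s sG] rad] att.
have size_s := rad s sG.
have [[Us _ cyc] [u [v [euv _]]]] := sG.
pose d : rel T := fun x y => (x, y) \in arc_orbit G u v.
have orG : orientation_of d e G by apply: half_arc_transitive_orientation.
have [eE asym dG trG] := orG.
have [_ vtr _ _] := hat.
have [_ A] := (G_alternating_orientation orG s (ex_intro _ u (ex_intro _ v euv))).1 sG.
have {}A := (alternating_next d Us).1 A.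
have [y0 [y1 [y2 [y3 [y4 [y5 H]]]]]] : exists y0 y1 y2 y3 y4 y5,
    hexagon d y0 y1 y2 y3 y4 y5.
  have asymE x y : e x y -> d y x = ~~ d x y.
    rewrite eE => /orP[dxy|dyx]; first by rewrite dxy (negPf (asym _ _ dxy)).
    by rewrite dyx asym.
  move: (Us) cyc A; rewrite {Us sG rad}.
  case: s size_s => [|y0 [|y1 [|y2 [|y3 [|y4 [|y5 []]]]]]] // _ U.
  set s := [:: y0; _; _; _; _; _] => cyc A; have n := next_nth_uniq y0 U.
  have n0 : next s y0 = y1 := n 0 isT.
  have n1 : next s y1 = y2 := n 1 isT.
  have n2 : next s y2 = y3 := n 2 isT.
  have n3 : next s y3 = y4 := n 3 isT.
  have n4 : next s y4 = y5 := n 4 isT.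
  have n5 : next s y5 = y0 := n 5 isT.
  move: cyc => /= /and5P[e0 e1 e2 e3 /and3P[e4 e5 _]].
  have A0 : d y0 y1 = d y2 y1.
    by have := A y0; rewrite n0 n1; apply; rewrite !inE eqxx ?orbT.
  have A1 : d y1 y2 = d y3 y2.
    by have := A y1; rewrite n1 n2; apply; rewrite !inE eqxx ?orbT.
  have A2 : d y2 y3 = d y4 y3.
    by have := A y2; rewrite n2 n3; apply; rewrite !inE eqxx ?orbT.
  have A3 : d y3 y4 = d y5 y4.
    by have := A y3; rewrite n3 n4; apply; rewrite !inE eqxx ?orbT.
  have A4 : d y4 y5 = d y0 y5.
    by have := A y4; rewrite n4 n5; apply; rewrite !inE eqxx ?orbT.
  have B0 := asymE _ _ e1; have B1 := asymE _ _ e2; have B2 := asymE _ _ e3.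
  have B3 := asymE _ _ e4; have B4 := asymE _ _ e5; have B5 := asymE _ _ e0.
  (* Directions flip from each cycle edge to the next, so edges two apart point the same way round.
     If [y0] is not a tail, the cycle is read from [y1] instead. *)
  have d23 : d y2 y3 = d y0 y1 by rewrite A0 B0 A1 B1 negbK.
  have d45 : d y4 y5 = d y0 y1 by rewrite -d23 A2 B2 A3 B3 negbK.
  case: (boolP (d y0 y1)) => d01.
    exists y0, y1, y2, y3, y4, y5.
    by rewrite /hexagon U -A0 -A2 -A4 d23 d45 d01.
  exists y1, y2, y3, y4, y5, y0; rewrite /hexagon -(rot_uniq 5) U B5 d01.
  have d12 : d y1 y2 by apply/negPn; rewrite -B0 -A0.
  have d34 : d y3 y4 by apply/negPn; rewrite -B2 -A2 d23.
  have d50 : d y5 y0 by apply/negPn; rewrite -B4 -A4 d45.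
  by rewrite -A1 -A3 d12 d34 d50.
have hexE x y : d x y -> exists x2 x3 x4 x5, hexagon d x y x2 x3 x4 x5.
  have /andP[_ /and5P[d01 _ _ _ _]] := H.
  case/(trG _ _ _ _ d01)=> g gG [<- <-].
  by exists (g y2), (g y3), (g y4), (g y5); rewrite (hexagon_perm orG).
(* Vertex transitivity moves the tail [y0] and the head [y1] of the hexagon to [x], giving two
   out-neighbours and two in-neighbours. These are distinct by asymmetry, and valency 4 leaves no
   others. *)
have nbrs x : exists a b p q, forall z,
   d x z = (z \in [:: a; b]) /\ d z x = (z \in [:: p; q]).
  have /andP[_ /and5P[d01 d21 _ _ /andP[_ d05]]] := H.
  have [g gG gx] := vtr y0 x; have [h hG hx] := vtr y1 x.
  exists (g y1), (g y5), (h y0), (h y2).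
  have n15 : g y1 != g y5.
    rewrite (inj_eq perm_inj); apply/eqP=> E.
    by have /andP[U _] := H; subst; not_uniq U.
  have n02 : h y0 != h y2.
    rewrite (inj_eq perm_inj); apply/eqP=> E.
    by have /andP[U _] := H; subst; not_uniq U.
  have g1 : d x (g y1) by rewrite -gx dG.
  have g5 : d x (g y5) by rewrite -gx dG.
  have h0 : d (h y0) x by rewrite -hx dG.
  have h2 : d (h y2) x by rewrite -hx dG.
  have U : uniq [:: g y1; g y5; h y0; h y2].
    rewrite /= !inE !negb_or n15 n02 !andbT /=.
    by apply/and3P; split; [apply/andP; split| |]; apply/eqP=> E;
      move: (asym _ _ g1) (asym _ _ g5); rewrite E ?h0 ?h2.
  have EN : [set z | e x z] =i [:: g y1; g y5; h y0; h y2].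
    apply/fsym/subset_cardP.
      by rewrite deg; apply/card_uniqP.
    apply/subsetP=> z; rewrite !inE eE.
    by case/or4P=> /eqP->; rewrite ?g1 ?g5 ?h0 ?h2 ?orbT.
  move=> z; have := EN z; rewrite !inE eE => {}EN.
  have gz := asym x z.
  split; apply/idP/orP.
  - move=> xz; move: EN; rewrite xz => /esym/or4P[->|->|/eqP E|/eqP E]; auto.
    + by move: (gz xz); rewrite E h0.
    + by move: (gz xz); rewrite E h2.
  - by case=> /eqP->.
  - move=> zx; move: EN; rewrite zx orbT => /esym/or4P[/eqP E|/eqP E|->|->]; auto.
    + by move: (asym _ _ zx); rewrite E g1.
    + by move: (asym _ _ zx); rewrite E g5.
  - by case=> /eqP->.
have out2 x y y' z : d x y -> d x y' -> y != y' -> d x z -> z = y \/ z = y'.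
  have [a [b [p [q N]]]] := nbrs x.
  rewrite !(N _).1 !inE.
  by case/orP=> /eqP-> /orP[]/eqP->; rewrite ?eqxx // => _ /orP[]/eqP->; auto.
have in2 x y y' z : d y x -> d y' x -> y != y' -> d z x -> z = y \/ z = y'.
  have [a [b [p [q N]]]] := nbrs x.
  rewrite !(N _).2 !inE.
  by case/orP=> /eqP-> /orP[]/eqP->; rewrite ?eqxx // => _ /orP[]/eqP->; auto.
have out_ex x : exists y, d x y.
  have [a [b [p [q N]]]] := nbrs x.
  by exists a; rewrite (N a).1 !inE eqxx.
have in_ex x : exists y, d y x.
  have [a [b [p [q N]]]] := nbrs x.
  by exists p; rewrite (N p).2 !inE eqxx.
exists (cotail_class d), (class_rel out2 in2 hexE in_ex).
split; [split| | |].
- exact: (class_rel_sym orG).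
- exact: class_rel_irr.
- exact: (class_rel_regular orG).
- exact: (class_rel_two_arc_transitive orG).
- exact: (dart_class_iso orG).
Qed.

(** * The orientation of a dart graph and its hexagons *)

Lemma next_next_neq (T : eqType) (s : seq T) x :
  uniq s -> 2 < size s -> x \in s -> next s (next s x) != x.
Proof.
move=> U; rewrite -(size_rot (index x s)) => + xs.
have [i p Ep] := rot_to xs.
rewrite size_rot -(size_rot i) -!(next_rot i U) Ep.
move: U; rewrite -(rot_uniq i) Ep {Ep}.
case: p => [|y [|z p]] //= /and3P[]; rewrite !inE !negb_or.
by case/and3P=> xy xz _ _ _ _; rewrite eqxx [y == x]eq_sym (negPf xy) eqxx eq_sym.
Qed.

Section DartStructure.
Variables (T U : finType) (f : rel U) (tl hd : T -> U).
Hypothesis symf : symmetric f.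
Hypothesis irrf : irreflexive f.
Hypothesis cubic : regular_of_degree f 3.
Hypothesis dartP : forall x, f (tl x) (hd x).
Hypothesis dart_ex : forall u v, f u v -> exists x, tl x = u /\ hd x = v.
Hypothesis dart_inj : forall x y, tl x = tl y -> hd x = hd y -> x = y.

(** Stated through the coordinates [tl] and [hd], so that it applies to every graph isomorphic to a
    dart graph and not only to the type [dart f]. *)
Definition dart_arc : rel T := fun x y => (tl y == hd x) && (tl x != hd y).
Notation d := dart_arc.

Variable e : rel T.
Hypothesis eE : forall x y, e x y = d x y || d y x.

(** Three neighbours do not fit into a set of at most two elements. Taking [a] equal to [b] serves
    to avoid a single vertex. *)
Lemma third_neighbour v a b : exists c, [/\ f v c, c != a & c != b].
Proof.
case: (pickP [pred c | [&& f v c, c != a & c != b]]) => [c /and3P[]|no].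
  by exists c.
have /subset_leq_card : [set c | f v c] \subset [set a; b].
  apply/subsetP=> c; rewrite !inE => vc; have /negbT := no c.
  by rewrite /= vc /= negb_and !negbK.
by rewrite cubic cards2; case: (_ != _).
Qed.

Lemma tl_neq_hd x : tl x != hd x.
Proof. by apply/eqP=> E; have := dartP x; rewrite E irrf. Qed.

Lemma dart_arc_asym x y : d x y -> ~~ d y x.
Proof. by case/andP=> _ H; rewrite /d negb_and H. Qed.

Lemma dart_arc_out x : exists y, d x y.
Proof.
have [w [vw wx _]] := third_neighbour (hd x) (tl x) (tl x).
by have [y [ty hy]] := dart_ex vw; exists y; rewrite /d ty hy eqxx eq_sym.
Qed.

Lemma two_neighbours v a y y' z :
  f v a -> f v y -> f v y' -> f v z -> y != a -> y' != a -> z != a -> y != y' ->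
  z = y \/ z = y'.
Proof.
move=> va vy vy' vz ya y'a za yy'; case: (eqVneq z y) => [|zy]; first by left.
case: (eqVneq z y') => [|zy']; first by right.
have Us : uniq [:: a; y; y'; z].
  by rewrite /= !inE !negb_or !(eq_sym a) ya y'a za yy' eq_sym zy eq_sym zy'.
suff : #|[:: a; y; y'; z]| <= 3 by rewrite (card_uniqP Us).
rewrite -(cubic v); apply/subset_leq_card/subsetP=> w; rewrite !inE.
by case/or4P=> /eqP->.
Qed.

Lemma dart_arc_out2 x y y' z : d x y -> d x y' -> y != y' -> d x z ->
  z = y \/ z = y'.
Proof.
case/andP=> /eqP ty hy /andP[/eqP ty' hy'] yy' /andP[/eqP tz hz].
have hyy' : hd y != hd y'.
  by apply: contraNneq yy' => E; apply/eqP/dart_inj; rewrite // ty ty'.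
have fN w : tl w = hd x -> f (hd x) (hd w) by move<-.
have fx : f (hd x) (tl x) by rewrite symf.
rewrite eq_sym in hy; rewrite eq_sym in hy'; rewrite eq_sym in hz.
case: (two_neighbours fx (fN _ ty) (fN _ ty') (fN _ tz) hy hy' hz hyy') => E.
  by left; apply: dart_inj; rewrite ?tz ?ty.
by right; apply: dart_inj; rewrite ?tz ?ty'.
Qed.

Lemma dart_arc_in2 x y y' z : d y x -> d y' x -> y != y' -> d z x ->
  z = y \/ z = y'.
Proof.
case/andP=> /eqP hy ty /andP[/eqP hy' ty'] yy' /andP[/eqP hz tz].
have tyy' : tl y != tl y'.
  by apply: contraNneq yy' => E; apply/eqP/dart_inj; rewrite // -hy -hy'.
have fN w : tl x = hd w -> f (tl x) (tl w) by move->; rewrite symf.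
case: (two_neighbours (dartP x) (fN _ hy) (fN _ hy') (fN _ hz) ty ty' tz tyy') => E.
  by left; apply: dart_inj; rewrite // -hz -hy.
by right; apply: dart_inj; rewrite // -hz -hy'.
Qed.

(** For [v = hd x] with neighbours [a], [b], [c] and [x = (a,v)], the hexagon is (a,v), (v,b),
    (c,v), (v,a), (b,v), (v,c); antipodal darts are reverse to each other. *)
Lemma dart_hexagon x : exists x1 x2 x3 x4 x5, hexagon d x x1 x2 x3 x4 x5.
Proof.
have xv := dartP x; set v := hd x in xv; set a := tl x in xv.
have [b [vb ba _]] := third_neighbour v a a.
have [c [vc ca cb]] := third_neighbour v a b.
rewrite symf in xv.
have [x1 [t1 h1]] := dart_ex vb; have [x3 [t3 h3]] := dart_ex xv.
have [x5 [t5 h5]] := dart_ex vc.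
move: (vb) (vc); rewrite symf => bv; rewrite symf => cv.
have [x2 [t2 h2]] := dart_ex cv; have [x4 [t4 h4]] := dart_ex bv.
have neq u w : f u w -> u != w by apply: contraTneq => ->; rewrite irrf.
have va := neq _ _ xv; have nb := neq _ _ vb; have nc := neq _ _ vc.
have ab : a != b by rewrite eq_sym.
have ac : a != c by rewrite eq_sym.
have bc : b != c by rewrite eq_sym.
exists x1, x2, x3, x4, x5; apply/andP; split; last first.
  rewrite /d t1 t2 t3 t4 t5 h1 h2 h3 h4 h5 -/v -/a !eqxx.
  by rewrite ?ab ?ac ?bc ?ba ?ca ?cb.
apply: (@map_uniq _ _ (fun x => (tl x, hd x))).
rewrite /= t1 t2 t3 t4 t5 h1 h2 h3 h4 h5 -/v -/a !inE !xpair_eqE !eqxx /=.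
rewrite !(eq_sym _ v) !(negPf va, negPf nb, negPf nc) /=.
by rewrite !(negPf ab, negPf ac, negPf bc, negPf ba, negPf ca, negPf cb).
Qed.

(** * Every alternating cycle of a dart graph is centred at a vertex of the cubic graph *)

Section AlternatingCycle.
Variable s : seq T.
Hypothesis cycS : graph_cycle e s.
Hypothesis altS : alternating_wrt [set p | d p.1 p.2] s.

(** Either [x] enters [v] and is the tail of both its cycle edges, or it leaves [v] and is the head
    of both. *)
Definition alternates_at v x :=
  [&& hd x == v, d x (next s x) & d x (prev s x)] ||
  [&& tl x == v, d (next s x) x & d (prev s x) x].

Lemma alternates_at_next v x : x \in s ->
  alternates_at v x -> alternates_at v (next s x).
Proof.
have [Us _ cyc] := cycS; move=> xs.
have ys : next s x \in s by rewrite mem_next.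
have := altS ys; rewrite !inE /= prev_next // => A.
have := next_cycle cyc ys; rewrite eE => ey.
rewrite /alternates_at prev_next //.
case/orP=> /and3P[/eqP <- nx _]; apply/orP.
  by right; rewrite -A nx andbT andbT; case/andP: nx.
left; rewrite nx andbT; apply/andP; split; first by case/andP: nx; rewrite eq_sym.
by move: ey; rewrite -A (negPf (dart_arc_asym nx)) orbF.
Qed.

(** The centre is read off at one vertex, as its [hd] if it is a tail and its [tl] if it is a head;
    iterating [next] carries it round the cycle. *)
Lemma alternating_center : exists v, {in s, forall x, alternates_at v x}.
Proof.
have [Us s3 cyc] := cycS.
have [x xs] : exists x, x \in s by case: (s) s3 => // x p; exists x; rewrite inE eqxx.
have ext v y : y \in s -> alternates_at v y -> {in s, forall z, alternates_at v z}.
  move=> ys ay z zs; have fc := cycle_next Us.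
  rewrite -(fconnect_cycle fc ys) in zs; rewrite -(iter_findex zs).
  elim: (findex _ _ _) => //= n IH; apply: alternates_at_next => //.
  by rewrite -(fconnect_cycle fc ys) fconnect_iter.
have := altS xs; rewrite !inE /= => A.
have := next_cycle cyc xs; have := prev_cycle cyc xs; rewrite !eE.
case: (boolP (d (next s x) x)) A => [dn dp _ _|dn dp].
  by exists (tl x); apply: (ext _ x) => //; rewrite /alternates_at eqxx dn dp orbT.
rewrite dp orbF /= => xp xn.
by exists (hd x); apply: (ext _ x) => //; rewrite /alternates_at eqxx xp xn.
Qed.

Variable v : U.
Hypothesis centerS : {in s, forall x, alternates_at v x}.

Lemma alternating_hd x : x \in s -> hd x = v ->
  d x (next s x) /\ d x (prev s x).
Proof.
move=> xs xv; case/orP: (centerS xs) => /and3P[] //; rewrite -xv => E.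
by case/negP: (tl_neq_hd x).
Qed.

Lemma alternating_tl x : x \in s -> tl x = v ->
  d (next s x) x /\ d (prev s x) x.
Proof.
move=> xs xv; case/orP: (centerS xs) => /and3P[] //; rewrite -xv eq_sym => E.
by case/negP: (tl_neq_hd x).
Qed.

Lemma next_neq_prev x : x \in s -> next s x != prev s x.
Proof.
have [Us s3 _] := cycS; move=> xs; have := next_next_neq Us s3 xs.
by apply: contraNneq => ->; rewrite next_prev.
Qed.

Lemma alternating_out x y : x \in s -> hd x = v -> d x y ->
  y = next s x \/ y = prev s x.
Proof.
by move=> xs xv; have [dn dp] := alternating_hd xs xv;
  apply: dart_arc_out2 dn dp (next_neq_prev xs).
Qed.

Lemma alternating_in x y : x \in s -> tl x = v -> d y x ->
  y = next s x \/ y = prev s x.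
Proof.
by move=> xs xv; have [dn dp] := alternating_tl xs xv;
  apply: dart_arc_in2 dn dp (next_neq_prev xs).
Qed.

Lemma alternating_out_mem x y : x \in s -> hd x = v -> d x y -> y \in s.
Proof.
by move=> xs xv /(alternating_out xs xv)[]->; rewrite ?mem_next ?mem_prev.
Qed.

Lemma alternating_in_mem x y : x \in s -> tl x = v -> d y x -> y \in s.
Proof.
by move=> xs xv /(alternating_in xs xv)[]->; rewrite ?mem_next ?mem_prev.
Qed.

(** The cycle is closed under arcs leaving its darts into [v] and arcs entering its darts out of
    [v], and valency 3 lets such steps reach every dart at [v]. *)
Lemma mem_alternating x : (x \in s) = (hd x == v) || (tl x == v).
Proof.
apply/idP/idP => [xs|].
  by case/orP: (centerS xs) => /and3P[->]; rewrite ?orbT.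
have [x0 x0s x0v] : exists2 x0, x0 \in s & hd x0 = v.
  have [_ s3 _] := cycS.
  have [y ys] : exists y, y \in s by case: (s) s3 => // y p; exists y; rewrite inE eqxx.
  case/orP: (centerS ys) => /and3P[/eqP yv]; first by exists y.
  case/andP=> /eqP E _ _; exists (next s y); first by rewrite mem_next.
  by rewrite -E.
have hdS y : hd y = v -> y \in s.
  (* As [u] avoids both tails, the dart (v,u) is an out-neighbour of [x0] and of [y], and links
     them. *)
  move=> yv; have [u [vu ux uy]] := third_neighbour v (tl x0) (tl y).
  have [w [wv wu]] := dart_ex vu.
  have ws : w \in s.
    by apply: (alternating_out_mem x0s x0v); rewrite /d wv x0v wu eqxx eq_sym.
  by apply: (alternating_in_mem ws wv); rewrite /d wv yv wu eqxx eq_sym.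
case/orP=> /eqP xv; first exact: hdS.
have [u [vu ux _]] := third_neighbour v (hd x) (hd x).
rewrite symf in vu; have [w [wu wv]] := dart_ex vu.
by apply: (alternating_out_mem (hdS _ wv) wv); rewrite /d wv wu xv eqxx.
Qed.

Lemma size_alternating : size s = 6.
Proof.
have [Us _ _] := cycS; rewrite -(card_uniqP Us).
have -> : #|s| = #|[set x | hd x == v] :|: [set x | tl x == v]|.
  by apply: eq_card => x; rewrite mem_alternating !inE.
rewrite cardsU; have -> : [set x | hd x == v] :&: [set x | tl x == v] = set0.
  apply/setP=> x; rewrite !inE; apply/negP=> /andP[/eqP <- E].
  by case/negP: (tl_neq_hd x).
rewrite cards0 subn0.
have -> : #|[set x | hd x == v]| = 3.
  rewrite -(cubic v) -(card_in_imset (f := tl)); last first.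
    by move=> x y; rewrite !inE => /eqP Ex /eqP Ey E; apply: dart_inj; rewrite // Ex.
  congr #|pred_of_set _|; apply/setP=> u; rewrite inE; apply/imsetP/idP.
    by case=> x; rewrite inE => /eqP <- ->; rewrite symf.
  by rewrite symf => /dart_ex[x [xu xv]]; exists x; rewrite ?inE ?xv.
suff -> : #|[set x | tl x == v]| = 3 by [].
rewrite -(cubic v) -(card_in_imset (f := hd)); last first.
  by move=> x y; rewrite !inE => /eqP Ex /eqP Ey E; apply: dart_inj; rewrite // Ex.
congr #|pred_of_set _|; apply/setP=> u; rewrite inE; apply/imsetP/idP.
  by case=> x; rewrite inE => /eqP <- ->.
by case/dart_ex=> x [xv xu]; exists x; rewrite ?inE ?xv.
Qed.

(** The right-hand side depends only on the centre, so distinct cycles have distinct centres. *)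
Lemma cycle_arcs_alternating : cycle_arcs s =
  [set p | (hd p.1 == v) && d p.1 p.2 || (tl p.1 == v) && d p.2 p.1].
Proof.
have [Us _ _] := cycS; apply/setP=> -[x y]; rewrite !inE /=.
apply/andP/idP => [[xs xy]|].
  have {}xy : y = next s x \/ y = prev s x.
    by case/orP: xy => /eqP ->; [left | right; rewrite prev_next].
  by case/orP: (centerS xs) => /and3P[-> dn dp]; case: xy => ->; rewrite ?dn ?dp ?orbT.
have fin : x \in s -> y = next s x \/ y = prev s x ->
    x \in s /\ (y == next s x) || (x == next s y).
  by move=> xs [->|->]; rewrite ?eqxx ?next_prev ?eqxx ?orbT.
case/orP=> /andP[/eqP xv dxy].
  have xs : x \in s by rewrite mem_alternating xv eqxx.
  exact/fin/alternating_out.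
have xs : x \in s by rewrite mem_alternating xv eqxx orbT.
exact/fin/alternating_in.
Qed.

End AlternatingCycle.

(** * The automorphism group of the cubic graph acting on darts *)

Hypothesis two_arcf : two_arc_transitive f.

(** The image of the automorphism group of [f] in its action on darts. *)
Definition dart_perms : {set {perm T}} := [set g : {perm T} |
  [exists h : {perm U}, (h \in graph_aut f) &&
     [forall x, (tl (g x) == h (tl x)) && (hd (g x) == h (hd x))]]].

Lemma dart_permsP (g : {perm T}) :
  reflect (exists2 h : {perm U}, h \in graph_aut f &
             forall x, tl (g x) = h (tl x) /\ hd (g x) = h (hd x))
          (g \in dart_perms).
Proof.
rewrite inE; apply: (iffP existsP) => [[h /andP[hA /forallP H]]|[h hA H]];
  exists h; rewrite ?hA //.
  by move=> x; have /andP[/eqP-> /eqP->] := H x.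
by apply/forallP=> x; have [-> ->] := H x; rewrite !eqxx.
Qed.

Lemma graph_autP (h : {perm U}) :
  reflect (forall u w, f (h u) (h w) = f u w) (h \in graph_aut f).
Proof.
rewrite inE; apply: (iffP forallP) => [H u w|H u].
  by have /forallP/(_ w)/eqP := H u.
by apply/forallP=> w; rewrite H.
Qed.

Lemma dart_perms_group_set : group_set dart_perms.
Proof.
apply/group_setP; split.
  apply/dart_permsP; exists 1%g; first by apply/graph_autP=> u w; rewrite !perm1.
  by move=> x; rewrite !perm1.
move=> g g' /dart_permsP[h /graph_autP hA H] /dart_permsP[h' /graph_autP hA' H'].
apply/dart_permsP; exists (h * h')%g.
  by apply/graph_autP=> u w; rewrite !permM hA' hA.
by move=> x; rewrite !permM; have [-> ->] := H' (g x); have [-> ->] := H x.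
Qed.

Canonical dart_perms_group := Group dart_perms_group_set.

Lemma dart_perm_lift (h : {perm U}) : h \in graph_aut f ->
  exists2 g, g \in dart_perms & forall x, tl (g x) = h (tl x) /\ hd (g x) = h (hd x).
Proof.
move=> hA; have /graph_autP fh := hA.
have ex x : exists y, (tl y == h (tl x)) && (hd y == h (hd x)).
  have : f (h (tl x)) (h (hd x)) by rewrite fh.
  by case/dart_ex=> y [ty hy]; exists y; rewrite ty hy !eqxx.
pose g x := xchoose (ex x).
have gP x : tl (g x) = h (tl x) /\ hd (g x) = h (hd x).
  by have /andP[/eqP ? /eqP ?] := xchooseP (ex x).
have gI : injective g.
  move=> x y E; have [tx hx] := gP x; have [ty hy] := gP y.
  by apply: dart_inj; apply: (@perm_inj _ h); rewrite -?tx -?hx E ?ty ?hy.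
have H x : tl (perm gI x) = h (tl x) /\ hd (perm gI x) = h (hd x).
  by rewrite permE.
by exists (perm gI) => //; apply/dart_permsP; exists h.
Qed.

Lemma dart_arc_orientation : orientation_of d e dart_perms.
Proof.
split=> //; first exact: dart_arc_asym.
  move=> g /dart_permsP[h _ H] x y; have [tx hx] := H x; have [ty hy] := H y.
  by rewrite /d tx hx ty hy !(inj_eq perm_inj).
have arc x y : d x y -> two_arc f (tl x) (hd x) (hd y).
  by case/andP=> /eqP E n; rewrite /two_arc dartP n -E dartP.
move=> x y x' y' dxy dxy'.
have [h hA [h1 h2 h3]] := two_arcf (arc _ _ dxy) (arc _ _ dxy').
have [g gG H] := dart_perm_lift hA; exists g => //.
have [tx hx] := H x; have [ty hy] := H y.
move: dxy dxy' => /andP[/eqP E _] /andP[/eqP E' _].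
by split; apply: dart_inj; rewrite ?tx ?ty ?hx ?hy // E E'.
Qed.

(** Every dart is the tail of an arc, so transitivity on the orientation gives transitivity on
    vertices and edges. No element reverses an arc, because [d] is invariant and asymmetric;
    nonemptiness supplies an arc to test. *)
Lemma dart_half_arc_transitive : 0 < #|T| -> half_arc_transitive e dart_perms.
Proof.
have [_ asym dG trG] := dart_arc_orientation.
case/card_gt0P=> x0 _; split.
- apply/subsetP=> g gG; rewrite inE; apply/forallP=> x; apply/forallP=> y.
  by rewrite !eE !dG.
- move=> x x'; have [y xy] := dart_arc_out x; have [y' xy'] := dart_arc_out x'.
  by have [g gG [gx _]] := trG _ _ _ _ xy xy'; exists g.
- move=> x y x' y'; rewrite !eE => /orP[] dxy /orP[] dxy';
    have [g gG [g1 g2]] := trG _ _ _ _ dxy dxy'; exists g; auto.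
- move=> atr; have [y xy] := dart_arc_out x0.
  have [||g gG [g1 g2]] := atr x0 y y x0; rewrite ?eE ?xy ?orbT //.
  by have := asym _ _ xy; rewrite -(dG g gG) g1 g2 xy.
Qed.

Lemma dart_alternating s : 0 < #|T| -> G_alternating_cycle e dart_perms s ->
  graph_cycle e s /\ exists v, {in s, forall x, alternates_at s v x}.
Proof.
case/card_gt0P=> x0 _ sG; have [y xy] := dart_arc_out x0.
have [|cs alt] := (G_alternating_orientation dart_arc_orientation s _).1 sG.
  by exists x0, y; rewrite eE xy.
by split=> //; apply: alternating_center.
Qed.

Lemma dart_rad : 0 < #|T| -> rad_eq e dart_perms 3.
Proof.
move=> T0; split.
  have /card_gt0P[x _] := T0.
  have [x1 [x2 [x3 [x4 [x5 H]]]]] := dart_hexagon x.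
  exists [:: x; x1; x2; x3; x4; x5].
  exact: (hexagon_G_alternating dart_arc_orientation H).
by move=> s /(dart_alternating T0)[cs [v sv]]; apply: (size_alternating cs sv).
Qed.

(** Cycles with centres [v1] and [v2] share exactly the darts joining these; if there is one, the
    centres are adjacent and the shared darts are (v1,v2) and (v2,v1). *)
Lemma dart_att : 0 < #|T| -> att_eq e dart_perms 2.
Proof.
move=> T0 s1 s2 /(dart_alternating T0)[c1 [v1 sv1]].
move=> /(dart_alternating T0)[c2 [v2 sv2]].
rewrite (cycle_arcs_alternating c1 sv1) (cycle_arcs_alternating c2 sv2) => ne.
have {}ne : v1 != v2 by apply: contraNneq ne => ->.
have E : [set x | (x \in s1) && (x \in s2)] =
  [set x | (tl x == v1) && (hd x == v2) || (tl x == v2) && (hd x == v1)].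
  apply/setP=> x; rewrite !inE (mem_alternating c1 sv1) (mem_alternating c2 sv2).
  case: (eqVneq (hd x) v1) => [->|_]; case: (eqVneq (tl x) v1) => [->|_];
    by rewrite ?(negPf ne) ?andbF ?andbT ?orbF.
case=> x xx; have : x \in [set x | (x \in s1) && (x \in s2)] by rewrite inE.
rewrite E inE => v12; have {x xx v12} f12 : f v1 v2.
  by case/orP: v12 => /andP[/eqP <- /eqP <-]; rewrite // symf.
have [p [tp hp]] := dart_ex f12; rewrite symf in f12.
have [q [tq hq]] := dart_ex f12.
have -> : [set x | (tl x == v1) && (hd x == v2) || (tl x == v2) && (hd x == v1)]
    = [set p; q].
  apply/setP=> x; rewrite !inE; apply/idP/orP.
    by case/orP=> /andP[/eqP tx /eqP hx]; [left | right]; apply/eqP/dart_inj;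
      rewrite ?tx ?hx.
  by case=> /eqP->; rewrite ?tp ?hp ?tq ?hq !eqxx ?orbT.
rewrite cards2; suff -> : p != q by [].
by apply: contraNneq ne => pq; rewrite -tp pq tq.
Qed.

End DartStructure.

Theorem theorem1p3 (T : finType) (e : rel T) :
  simple_graph e -> 0 < #|T| -> connected_graph e -> regular_of_degree e 4 ->
  (exists G : {group {perm T}},
      [/\ half_arc_transitive e G, rad_eq e G 3 & att_eq e G 2])
  <->
  (exists (U : finType) (f : rel U),
      [/\ simple_graph f, regular_of_degree f 3, two_arc_transitive f
        & graph_iso e (dart_rel f)]).
Proof.
move=> simp T0 _ deg; split=> [[G [hat rad att]]|[U [f [[symf irrf] cub two]]]].
  exact: dart_of_rad3_att2 hat rad att.
case=> phi [psi phiK psiK] phiE.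
(* The isomorphism supplies the coordinates that make [T] a set of darts. *)
pose tl x := (val (phi x)).1; pose hd x := (val (phi x)).2.
have dartP x : f (tl x) (hd x) := valP (phi x).
have dart_ex u v : f u v -> exists x, tl x = u /\ hd x = v.
  move=> fuv; exists (psi (exist (fun p => f p.1 p.2) (u, v) fuv)).
  by rewrite /tl /hd psiK.
have dart_inj x y : tl x = tl y -> hd x = hd y -> x = y.
  move=> Et Eh; apply: (can_inj phiK); apply: val_inj.
  by rewrite [LHS]surjective_pairing [RHS]surjective_pairing -/(tl x) Et -/(hd x) Eh.
have eE x y : e x y = dart_arc tl hd x y || dart_arc tl hd y x.
  by rewrite -phiE /dart_rel /dart_arc /tl /hd; case: (val (phi x)) (val (phi y)) => [? ?] [? ?].
exists (dart_perms_group f tl hd); split.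
- exact: (dart_half_arc_transitive cub dartP dart_ex dart_inj eE two T0).
- exact: (dart_rad symf irrf cub dartP dart_ex dart_inj eE two T0).
- exact: (dart_att symf irrf cub dartP dart_ex dart_inj eE two T0).
Qed.
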